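(* Fix an integer $q\geq 3$. There is a function $\delta(n)\to 0$ as $n\to\infty$ such that for all sufficiently large $n$ there exists a graph $G$ on $n+1$ vertices with $r(G;q) > n^{1+\frac{3q-5}{8q\log q}-\delta(n)}$, together with a vertex $v\in V(G)$ such that $H=G\setminus\{v\}$ satisfies $r(H;q)=n$. In particular, there is $\alpha>0$ depending only on $q$ such that for all sufficiently large $n$ these graphs satisfy $r(G;q)\geq r(H;q)^{1+\alpha}$.
   Context: For an integer $q\geq 2$ and a graph $F$, the $q$-color Ramsey number $r(F;q)$ is the least $N$ such that every coloring of the edges of $K_N$ with $q$ colors contains a monochromatic copy of $F$. Logarithms are to base $2$. *)

(* Defs.v *)
From mathcomp Require Import all_boot.
From Stdlib Require Import Reals ClassicalDescription.

Set Implicit Arguments.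
Unset Strict Implicit.
Unset Printing Implicit Defensive.

Definition simple_graph (V : finType) (e : rel V) : Prop :=
  (forall x y, e x y = e y x) /\ (forall x, e x x = false).

(* A q-edge-colouring of K_N: a symmetric map c : 'I_N -> 'I_N -> 'I_q;
   only the values c x y with x <> y are meaningful (edges of K_N).
   K_N -> (F)_q : every q-colouring of K_N contains a monochromatic copy of F,
   i.e. an injective vertex map f and a colour i such that every edge of F
   is mapped to an edge of colour i. *)
Definition arrows (V : finType) (e : rel V) (q N : nat) : Prop :=
  forall c : 'I_N -> 'I_N -> 'I_q,
    (forall x y, c x y = c y x) ->
    exists f : V -> 'I_N, injective f /\
      exists i : 'I_q, forall x y, e x y -> c (f x) (f y) = i.

Definition asb (P : Prop) : bool :=
  if excluded_middle_informative P then true else false.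

(* r(F;q): the least N such that K_N -> (F)_q (0 if no such N exists,
   which never happens for q >= 1 by Ramsey's theorem). *)
Definition ramsey_number (V : finType) (e : rel V) (q : nat) : nat :=
  match excluded_middle_informative
          (exists N, asb (arrows e q N)) with
  | left H => ex_minn H
  | right _ => 0
  end.

Definition delete_vertex (V : finType) (e : rel V) (v : V) :
  rel {x : V | x != v} :=
  fun x y => e (proj1_sig x) (proj1_sig y).

Definition log2 (x : R) : R := (ln x / ln 2)%R.
Arguments delete_vertex {V} e v _ _.

(* Main.v *)
Require Import Defs.
From mathcomp Require Import all_boot all_algebra zify.
From Stdlib Require Import Reals Lra ClassicalDescription.
(* Reals rebinds some of the arithmetic notations of nat_scope. *)
From mathcomp Require Import ssrnat.

(* [H] is a clique [K_k] together with [n - k] isolated vertices, where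
   [q ^ (q * k) <= n < q ^ (q * (k + 1))], and [G] adds a vertex [v] joined to everything.
   Since [r(K_k; q) <= q ^ (q * k) <= n], the isolated vertices decide: [r(H; q) = n].
   For [G], take [M] blocks of [n] vertices, give the last colour to the pairs inside a block,
   and colour the pairs of blocks with [q - 1] colours without a monochromatic [K_(k+1)]. The
   last colour has only components of size [n], so it does not contain the connected graph
   [G] on [n + 1] vertices, whence [r(G; q) > n * M].

   A good [(q - 1)]-colouring comes from the constructions of Conlon-Ferber and Wigderson.
   On [F_2 ^ (2 m)] join two vectors when their symplectic product is [1]. A clique of even
   size [s] has the invertible Gram matrix [J - I], so [s <= 2 m]; independent sets span
   totally isotropic subspaces, so there are only [2 ^ (5/8 s ^ 2 + o(s ^ 2))] independent
   [s]-tuples, [s = 2 m + 2]. Pull the graph back along [q - 3] successive maps, each chosen by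
   averaging so as to leave few uncoloured [s]-cliques, and use the last two colours at random
   on the pairs left. This works up to [M = 2 ^ ((3 q - 5) m / 4 - O(q))]. *)

Set Implicit Arguments.
Unset Strict Implicit.
Unset Printing Implicit Defensive.

Lemma card_le_in (S T : finType) (f : S -> T) (A : {pred S}) (B : {pred T}) :
  {in A &, injective f} -> (forall x, x \in A -> f x \in B) -> #|A| <= #|B|.
Proof.
move=> finj fAB; rewrite -(card_in_imset finj); apply/subset_leq_card/subsetP.
by move=> _ /imsetP[x Ax ->]; apply: fAB.
Qed.

(** * Isotropic tuples and cliques for the symplectic form over [F_2] *)

Section Symplectic.
Import GRing.Theory.
Local Open Scope ring_scope.

Lemma card_submx_le (F : finFieldType) (r n : nat) (A : 'M[F]_(r, n)) :
  (#|[set x : 'rV[F]_n | (x <= A)%MS]| <= #|F| ^ \rank A)%N.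
Proof.
have -> : (#|F| ^ \rank A)%N = #|{: 'rV[F]_(\rank A)}| by rewrite card_mx mul1n.
apply: leq_trans (leq_imset_card (fun u => u *m row_base A) _).
apply/subset_leq_card/subsetP => x; rewrite inE -(eq_row_base A) => /submxP[u ->].
exact: imset_f.
Qed.

Definition symp m : 'M['F_2]_(m + m) := block_mx 0 1%:M 1%:M 0.

Lemma symp_tr m : (symp m)^T = symp m.
Proof. by rewrite tr_block_mx !trmx0 trmx1. Qed.

Lemma symp_unit m : symp m \in unitmx.
Proof.
have: symp m *m symp m = 1%:M.
  by rewrite mulmx_block !mul0mx !mulmx1 !mulmx0 !addr0 !add0r -scalar_mx_block.
by case/mulmx1_unit.
Qed.

Lemma symp_alt m (x : 'rV['F_2]_(m + m)) : x *m symp m *m x^T = 0.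
Proof.
rewrite -(hsubmxK x) mul_row_block tr_row_mx mul_row_col.
rewrite !mulmx0 !mulmx1 add0r addr0.
set a := lsubmx x; set b := rsubmx x.
have -> : b *m a^T = a *m b^T.
  by apply/matrixP=> i j; rewrite !ord1 !mxE; apply: eq_bigr => k _; rewrite !mxE mulrC.
by apply/matrixP=> i j; rewrite mxE [RHS]mxE addrr_pchar2 // pchar_Fp.
Qed.

(** Stated for matrices, so that one equation covers all pairs of rows; [perp X X] means that the
    rows of [X] span a totally isotropic space. *)
Definition perp m r s (X : 'M['F_2]_(r, m + m)) (Y : 'M['F_2]_(s, m + m)) : bool :=
  X *m symp m *m Y^T == 0.

(** Rows are placed one at a time, [W] being a basis of the span so far. The next row is one of at
    most [2 ^ r] vectors in the span of [W], which keeps [W], or one of at most [2 ^ (2 m - r)]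
    orthogonal vectors, which raises [r]; the binomial pays for the excess [m - r] of the second
    case. *)
Lemma card_isotropic_ext m T r (W : 'M['F_2]_(r, m + m)) :
    row_free W -> perp W W ->
  (#|[set X : 'M['F_2]_(T, m + m) |
       perp X W && perp X X]|
    <= 2 ^ (T * m.+1 + 'C((m - r).+1, 2)))%N.
Proof.
have rankM s (Y : 'M['F_2]_(s, m + m)) : row_free Y -> \rank (symp m *m Y^T) = s.
  by move=> /eqP Yf; rewrite -mxrank_tr trmx_mul trmxK symp_tr mxrankMfree // row_free_unit symp_unit.
have le_m s (Y : 'M['F_2]_(s, m + m)) : row_free Y -> perp Y Y -> (s <= m)%N.
  move=> Yf /eqP Y0; have: (Y <= kermx (symp m *m Y^T))%MS by apply/sub_kermxP; rewrite mulmxA.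
  by move/mxrankS; rewrite mxrank_ker rankM // (eqP Yf); lia.
elim: T r W => [|T IH] r W Wf W0.
  apply: leq_trans (max_card _) _.
  by rewrite card_mx mul0n expn0 expn_gt0.
have r_le_m := le_m _ _ Wf W0.
pose S s (Y : 'M['F_2]_(s, m + m)) := [set X : 'M['F_2]_(T, m + m) |
       perp X Y && perp X X].
pose P := [set x : 'rV['F_2]_(m + m) | perp x W].
pose Q := [set x : 'rV['F_2]_(m + m) | (x <= W)%MS].
have cardQ : (#|Q| <= 2 ^ r)%N.
  by have := card_submx_le W; rewrite (eqP Wf) card_Fp.
have cardP : (#|P| <= 2 ^ (m + m - r))%N.
  have := card_submx_le (kermx (symp m *m W^T)); rewrite mxrank_ker rankM // card_Fp //.
  apply: leq_trans; apply/subset_leq_card/subsetP => x; rewrite !inE => /eqP x0.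
  by apply/sub_kermxP; rewrite mulmxA.
have step : (#|[set X : 'M['F_2]_(1 + T, m + m) |
       perp X W && perp X X]|
    <= \sum_(x in P) #|S _ (col_mx x W)|)%N.
  rewrite -sum1_card (partition_big (fun X : 'M_(1 + T, m + m) => usubmx X) (mem P)) /=; last first.
    move=> X; rewrite !inE /perp -{1}(vsubmxK X) !mul_col_mx => /andP[/eqP + _].
    by rewrite -(col_mx0) => /eq_col_mx[-> _].
  apply: leq_sum => x _; rewrite sum1_card.
  apply: (@card_le_in _ _ (fun X : 'M_(1 + T, m + m) => dsubmx X)).
    move=> X Y /andP[_ /eqP X1] /andP[_ /eqP Y1] XY.
    by rewrite -(vsubmxK X) -(vsubmxK Y) X1 Y1 XY.
  move=> X /andP[+ /eqP <-]; rewrite !inE => /andP[/eqP XW /eqP XX].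
  move: XW XX; rewrite -{1 2 3}(vsubmxK X) tr_col_mx !mul_col_mx !mul_mx_row.
  rewrite -{1}(col_mx0) => /eq_col_mx[_ XW].
  rewrite -[0 in X in X -> _]block_mx0 => /eq_block_mx[_ _ X10 X11].
  by rewrite /perp tr_col_mx mul_mx_row X10 XW row_mx0 X11 !eqxx.
rewrite -[T.+1]add1n; apply: leq_trans step _.
rewrite (bigID (mem Q)) /=.
(* Each of the two cases fits into the exponent without the successor; adding them costs one factor
   2, hence [m.+1] per row. *)
have -> : ((1 + T) * m.+1 + 'C((m - r).+1, 2) = (m + (T * m.+1 + 'C((m - r).+1, 2))).+1)%N.
  by lia.
rewrite expnS mul2n -addnn leq_add //.
  apply: leq_trans (_ : \sum_(x in Q) 2 ^ (T * m.+1 + 'C((m - r).+1, 2)) <= _)%N.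
    rewrite big_mkcond [in leqRHS]big_mkcond /=; apply: leq_sum => x _.
    case: (x \in Q); rewrite ?andbF // andbT; case: ifP => // _.
    apply: leq_trans (IH _ _ Wf W0); apply/subset_leq_card/subsetP => X; rewrite !inE.
    by rewrite /perp tr_col_mx mul_mx_row -row_mx0 => /andP[/eqP/eq_row_mx[_ ->] ->]; rewrite eqxx.
  rewrite sum_nat_const [in leqRHS]expnD leq_mul2r; apply/orP; right.
  by apply: leq_trans cardQ _; rewrite leq_exp2l.
apply: leq_trans (_ : \sum_(x in P) 2 ^ (T * m.+1 + 'C(m - r, 2)) <= _)%N; last first.
  rewrite sum_nat_const; apply: leq_trans (leq_mul cardP (leqnn _)) _.
  by rewrite -expnD leq_exp2l // [in leqRHS]binS bin1; lia.
rewrite [in leqRHS](bigID (mem Q)) /=; apply: leq_trans (leq_addl _ _).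
apply: leq_sum => x; rewrite !inE => /andP[/eqP xW xNW].
have Wxf : row_free (col_mx x W).
  rewrite /row_free -addsmxE; apply/eqP.
  have x0 : x != 0 by apply: contraNneq xNW => ->; rewrite sub0mx.
  rewrite mxrank_disjoint_sum; first by rewrite rank_rV x0 (eqP Wf).
  apply/eqP; rewrite -mxrank_eq0 -leqn0 -ltnS.
  have : (\rank (x :&: W)%MS < \rank x)%N.
    rewrite ltn_neqAle mxrankS ?capmxSl // andbT (mxrank_leqif_sup (capmxSl x W)).
    by rewrite sub_capmx submx_refl.
  by rewrite rank_rV x0.
have Wx0 : perp (col_mx x W) (col_mx x W).
  apply/eqP; rewrite tr_col_mx !mul_col_mx !mul_mx_row symp_alt xW (eqP W0).
  have -> : W *m symp m *m x^T = 0.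
    by apply: trmx_inj; rewrite !trmx_mul trmxK symp_tr mulmxA xW trmx0.
  by rewrite !row_mx0 col_mx0.
(* This makes the truncated [m - r.+1] exact, so that [IH] yields ['C(m - r, 2)]. *)
have r_lt_m : (r < m)%N := le_m _ _ Wxf Wx0.
by apply: leq_trans (IH _ _ Wxf Wx0) _; rewrite add1n -subSn // subSS.
Qed.

Lemma perp_sym m (x y : 'rV['F_2]_(m + m)) : perp x y = perp y x.
Proof.
by rewrite /perp -[LHS](inj_eq trmx_inj) !trmx_mul trmxK symp_tr mulmxA trmx0.
Qed.

Lemma perp_xx m (x : 'rV['F_2]_(m + m)) : perp x x.
Proof. by rewrite /perp symp_alt. Qed.

Lemma perp_rows m r s (X : 'M['F_2]_(r, m + m)) (Y : 'M['F_2]_(s, m + m)) i j :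
  perp (row i X) (row j Y) = ((X *m symp m *m Y^T) i j == 0).
Proof.
have -> : perp (row i X) (row j Y) = (((X *m symp m *m Y^T) i j)%:M == 0 :> 'M_1).
  congr (_ == 0); apply/matrixP => a b; rewrite !ord1 -row_mul !mxE eqxx mulr1n.
  by apply: eq_bigr => k _; rewrite !mxE.
apply/eqP/eqP => [/matrixP/(_ 0 0)|->]; last exact: raddf0.
by rewrite !mxE eqxx mulr1n.
Qed.

Lemma card_perp_family m s :
  (#|[set g : {ffun 'I_s -> 'rV['F_2]_(m + m)} | [forall i, forall j, perp (g i) (g j)]]|
    <= 2 ^ (s * m.+1 + 'C(m.+1, 2)))%N.
Proof.
have W0 : perp (0 : 'M['F_2]_(0, m + m)) (0 : 'M_(0, m + m)) by rewrite /perp !mul0mx.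
have Wf : row_free (0 : 'M['F_2]_(0, m + m)) by rewrite /row_free mxrank0.
have := card_isotropic_ext s Wf W0; rewrite subn0; apply: leq_trans.
apply: (@card_le_in _ _ (fun g : {ffun 'I_s -> 'rV['F_2]_(m + m)} => \matrix_i g i)).
  move=> g h _ _ gh; apply/ffunP => i.
  by rewrite -[g i](rowK (fun i => g i)) gh rowK.
move=> g; rewrite !inE => /forallP gP; rewrite /perp trmx0 mulmx0 eqxx /=.
apply/eqP/matrixP => i j; rewrite [RHS]mxE; apply/eqP; rewrite -perp_rows !rowK.
by have /forallP := gP i.
Qed.

(** For even [s], both [J ^ 2 = s J] and [2 J] vanish, so [J - I] is its own inverse. The Gram
    matrix then has rank [s], but it factors through dimension [2 m]. *)
Lemma non_perp_family_size m s (g : 'I_s -> 'rV['F_2]_(m + m)) :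
  ~~ odd s -> (forall i j, i != j -> ~~ perp (g i) (g j)) -> (s <= m + m)%N.
Proof.
move=> s_even gP; pose X := \matrix_i g i.
have XX : X *m symp m *m X^T = const_mx 1 - 1%:M.
  apply/matrixP => i j; have -> : (const_mx 1 - 1%:M) i j = (i != j)%:R :> 'F_2.
    by rewrite !mxE; case: eqVneq; rewrite ?subrr ?subr0.
  case: eqVneq => [<-|ij]; first by apply/eqP; rewrite -perp_rows perp_xx.
  have := gP _ _ ij; rewrite -[g i](rowK (fun i => g i)) -[g j](rowK (fun i => g i)) perp_rows.
  by case: (_ i j) => -[|[|k]] //= *; apply/val_inj.
have JJ : (const_mx 1 : 'M['F_2]_s) *m (const_mx 1 : 'M['F_2]_s) = 0.
  apply/matrixP => i j; rewrite !mxE (eq_bigr (fun=> 1)) => [|k _]; last by rewrite !mxE mulr1.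
  rewrite sumr_const card_ord; apply/eqP; rewrite -(dvdn_pcharf (pchar_Fp (isT : prime 2))).
  by rewrite dvdn2.
have : (const_mx 1 - 1%:M : 'M['F_2]_s) *m (const_mx 1 - 1%:M) = 1%:M.
  have J2 : const_mx 1 + const_mx 1 = 0 :> 'M['F_2]_s.
    by apply/matrixP => i j; rewrite !mxE addrr_pchar2 // pchar_Fp.
  by rewrite mulmxBl !mulmxBr JJ !mulmx1 !mul1mx sub0r opprB addrCA -opprD J2 subr0.
case/mulmx1_unit; rewrite -XX -row_full_unit => /eqP rk _; rewrite -{1}rk.
by apply: leq_trans (mxrankM_maxl _ _) _; apply: leq_trans (mxrankM_maxl _ _) _; apply: rank_leq_col.
Qed.

End Symplectic.

(** * Ramsey numbers of cliques with isolated vertices *)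

Lemma asbP (P : Prop) : reflect P (asb P).
Proof. by rewrite /asb; case: excluded_middle_informative => p; constructor. Qed.

Lemma ramsey_numberP (V : finType) (e : rel V) (q N : nat) :
    arrows e q N ->
  arrows e q (ramsey_number e q) /\ (forall M, arrows e q M -> ramsey_number e q <= M).
Proof.
move=> eN; rewrite /ramsey_number; case: excluded_middle_informative => [H|[]]; last first.
  by exists N; apply/asbP.
by case: ex_minnP => r /asbP er rmin; split=> // M eM; apply/rmin/asbP.
Qed.

Lemma arrows_leq (V : finType) (e : rel V) (q M N : nat) :
  M <= N -> arrows e q M -> arrows e q N.
Proof.
move=> leMN eM c csym.
have [|f [finj [i fi]]] := eM (fun x y => c (widen_ord leMN x) (widen_ord leMN y)).
  by move=> x y.
exists (fun x => widen_ord leMN (f x)); split; last by exists i.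
by move=> x y /(congr1 val) /= /val_inj /finj.
Qed.

(** Separate targets per colour allow induction on their sum: some colour [i] joins [x] to at least
    [q ^ L] points of [A]. Search among these with the target of [i] lowered by one, and put [x]
    back if the clique found has colour [i]. *)
Lemma monochromatic_clique (q : nat) (T : finType) (c : T -> T -> 'I_q) (ks : 'I_q -> nat)
    (A : {set T}) :
    1 < q -> (forall x y, c x y = c y x) -> q ^ (\sum_i ks i) <= #|A| ->
  exists i : 'I_q, exists S : {set T}, [/\ S \subset A, #|S| = ks i &
    {in S &, forall x y, x != y -> c x y = i}].
Proof.
move=> q1 csym; move def_L: (\sum_i ks i) => L.
elim: L ks A def_L => [|L IH] ks A def_L leA.
  have [i _] : exists i : 'I_q, true by exists (Ordinal (ltnW q1)).
  exists i, set0; rewrite sub0set cards0; split=> // [|x y]; last by rewrite inE.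
  by apply/esym/eqP; move/eqP: def_L; rewrite (bigD1 i) //= addn_eq0 => /andP[].
have [i /eqP ki0|kpos] := pickP (fun i => ks i == 0).
  exists i, set0; rewrite sub0set cards0; split=> // x y; by rewrite inE.
have /card_gt0P[x Ax] : 0 < #|A| by apply: leq_trans leA; rewrite expn_gt0 (ltnW q1).
have [i leB|small] := pickP (fun i => q ^ L <= #|[set y in A :\ x | c x y == i]|); last first.
  (* If every colour class at [x] were smaller than [q ^ L], then
     [#|A| <= q * (q ^ L - 1) + 1 < q ^ L.+1], because [1 < q]. *)
  have qL : 0 < q ^ L by rewrite expn_gt0 (ltnW q1).
  have: #|A :\ x| <= q * (q ^ L).-1.
    rewrite -sum1_card (partition_big (c x) xpredT) //=.
    have -> : q * (q ^ L).-1 = \sum_(i < q) (q ^ L).-1 by rewrite sum_nat_const card_ord.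
    apply: leq_sum => i _.
    by rewrite sum1dep_card -ltnS prednK // ltnNge; have /negbT := small i.
  rewrite -subn1 mulnBr muln1 -expnS; have := cardsD1 x A; rewrite Ax add1n => cA.
  move: leA; rewrite cA expnS => leA leA'.
 by lia.
pose ks' j := ks j - (j == i).
have def_L' : \sum_j ks' j = L.
  apply: succn_inj; rewrite -def_L (bigD1 i) //= [in RHS](bigD1 i) //= /ks' eqxx.
  have /negbT := kpos i; rewrite -lt0n => ki.
  rewrite -addSn subn1 prednK //; congr addn; apply: eq_bigr => j /negbTE ->.
  by rewrite subn0.
have [j [S [SB cardS Sj]]] := IH _ _ def_L' leB.
have SA : S \subset A.
  by apply: subset_trans SB _; apply/subsetP => y; rewrite !inE => /andP[/andP[]].
case: (eqVneq j i) cardS Sj => [->|jNi] cardS Sj; last first.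
  by exists j, S; split=> //; rewrite cardS /ks' (negbTE jNi) subn0.
have SxP y : y \in S -> (y != x) /\ c x y = i.
  by move/(subsetP SB); rewrite !inE => /andP[/andP[-> _] /eqP].
exists i, (x |: S); split.
- by rewrite subUset sub1set Ax.
- rewrite cardsU1 cardS /ks' eqxx; have /negbT := kpos i; rewrite -lt0n => ki.
  have -> : x \notin S by apply/negP => /SxP[]; rewrite eqxx.
  by rewrite add1n subn1 prednK.
move=> y z /setU1P[->|Sy] /setU1P[->|Sz] yz.
- by rewrite eqxx in yz.
- by case: (SxP _ Sz).
- by rewrite csym; case: (SxP _ Sy).
- exact: Sj.
Qed.

Lemma inj_into_set (V T : finType) (S : {set T}) :
  #|V| <= #|S| -> exists f : V -> T, injective f /\ forall x, f x \in S.
Proof.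
move=> leVS; exists (fun x => enum_val (widen_ord leVS (enum_rank x))); split.
  by move=> x y /enum_val_inj /(congr1 val) /= /val_inj /enum_rank_inj.
by move=> x; apply: enum_valP.
Qed.

Lemma inj_extend (V T : finType) (A : {set V}) (f : {x | x \in A} -> T) :
    injective f -> #|V| <= #|T| ->
  exists g : V -> T, injective g /\ forall u, g (val u) = f u.
Proof.
move=> finj leVT; pose B := [set f u | u : {x | x \in A}].
have : #|{: {x | x \notin A}}| <= #|~: B|.
  have := card_imset setT finj; rewrite cardsT !card_sig => cB.
  have -> : #|[pred x | x \notin A]| = #|~: A| by apply: eq_card => x; rewrite !inE.
  have BA : #|B| = #|A|.
    by rewrite -cB; apply: eq_card => y; apply/imsetP/imsetP => -[u _ ->]; exists u.
  by have := cardsC A; have := cardsC B; rewrite BA; lia.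
case/inj_into_set => h [hinj hP].
pose g x := match decP (@idP (x \in A)) with
  | left p => f (exist _ x p) | right p => h (exist _ x (introN idP p)) end.
have gA u : g (val u) = f u.
  rewrite /g; case: decP => [p|[]]; last exact: valP u.
  by congr f; apply: val_inj.
exists g; split=> // x y.
have fB u : f u \in B by apply: imset_f.
rewrite /g; case: decP => p; case: decP => p'.
- by move/finj/(congr1 val).
- by move=> E; have := hP (exist _ y (introN idP p')); rewrite -E inE fB.
- by move=> E; have := hP (exist _ x (introN idP p)); rewrite E inE fB.
- by move/hinj/(congr1 val).
Qed.

(** A monochromatic clique receives [A]; the vertices outside [A] are isolated and only need room.
    This serves for [H], and with [A] full for the existence of the Ramsey number of [G]. *)
Lemma arrows_clique (V : finType) (e : rel V) (q N : nat) (A : {set V}) :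
    1 < q -> irreflexive e -> (forall x y, e x y -> (x \in A) && (y \in A)) ->
    #|V| <= N -> q ^ (q * #|A|) <= N ->
  arrows e q N.
Proof.
move=> q1 eirr eA leVN leN c csym.
have [|i [S [_ cardS Si]]] := @monochromatic_clique q _ c (fun=> #|A|) setT q1 csym.
  by rewrite sum_nat_const card_ord cardsT card_ord.
have : #|{: {x | x \in A}}| <= #|S| by rewrite card_sig cardS.
case/inj_into_set => h [hinj hS].
have [|f [finj fh]] := inj_extend hinj; first by rewrite card_ord.
exists f; split=> //; exists i => x y exy; have /andP[xA yA] := eA _ _ exy.
have fS z (zA : z \in A) : f z \in S by rewrite (fh (exist _ z zA)).
apply: Si; rewrite ?fS //; apply/eqP => /finj xy.
by rewrite xy eirr in exy.
Qed.

(** * Averaging over random maps *)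

(** First moment method for a uniform [w], with the probability bound [a / d] written without
    division. *)
Lemma exists_le_average (Omega I : finType) (U : {set I}) (bad : I -> pred Omega) a d :
    0 < #|Omega| ->
    (forall u, u \in U -> #|[set w | bad u w]| * d <= #|Omega| * a) ->
  exists w, #|[set u in U | bad u w]| * d <= #|U| * a.
Proof.
move=> Omega_gt0 U_bad; apply/existsP; apply/contraT; rewrite negb_exists => /forallP none.
have: \sum_w #|[set u in U | bad u w]| * d <= #|U| * (#|Omega| * a).
  rewrite -big_distrl /= -sum_nat_const.
  under eq_bigr do rewrite -sum1dep_card big_mkcondr.
  rewrite exchange_big big_distrl /=; apply: leq_sum => u uU.
  by rewrite -big_mkcond sum1dep_card U_bad.
have -> : #|U| * (#|Omega| * a) = \sum_(w : Omega) #|U| * a by rewrite sum_nat_const mulnCA.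
rewrite leqNgt => /negP[].
have [w0 _] := card_gt0P Omega_gt0.
(* Strictness of the sum needs one term, which [w0] provides. *)
rewrite [ltnLHS](bigD1 w0) //= [ltnRHS](bigD1 w0) //= -addSn leq_add //.
  by rewrite ltnNge none.
by apply: leq_sum => w _; rewrite ltnW // ltnNge none.
Qed.

(** A uniform map on [B] restricts along the injection [u] to a uniform map on [A]: it is determined
    by this restriction and its values off the image of [u]. *)
Lemma card_ffun_comp_inj (A B T : finType) (u : A -> B) (P : pred {ffun A -> T}) :
    injective u ->
  #|[set f : {ffun B -> T} | P [ffun a => f (u a)]]| * #|T| ^ #|A| <=
    #|T| ^ #|B| * #|[set g | P g]|.
Proof.
move=> uinj; pose C := [set u a | a : A].
have cardC : #|{: {b | b \notin C}}| + #|A| = #|B|.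
  rewrite card_sig -(cardsC C) card_imset // addnC; congr (_ + _).
  by apply: eq_card => b; rewrite !inE.
rewrite -cardC expnD mulnAC leq_mul2r; apply/orP; right.
rewrite -card_ffun mulnC -[X in _ * X]cardsT -cardsX.
pose r (f : {ffun B -> T}) := ([ffun a => f (u a)], [ffun b : {b | b \notin C} => f (val b)]).
apply: leq_trans (_ : #|r @: [set f : {ffun B -> T} | P [ffun a => f (u a)]]| <= _).
  rewrite card_imset // => f g [/ffunP fg1 /ffunP fg2]; apply/ffunP => b.
  have [/imsetP[a _ ->]|bC] := boolP (b \in C); first by have := fg1 a; rewrite !ffunE.
  by have := fg2 (Sub b bC); rewrite !ffunE.
by apply/subset_leq_card/subsetP => _ /imsetP[f + ->]; rewrite !inE andbT.
Qed.

(** Each further random map sends an injective [s]-tuple to an independent one with probability at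
    most [a / #|V| ^ s], so a suitable choice shrinks the surviving set by that factor. *)
Lemma exists_pullbacks (V : finType) (adj : rel V) (s N j a : nat) :
    0 < #|V| ->
    #|[set g : {ffun 'I_s -> V} | [forall x, forall y, ~~ adj (g x) (g y)]]| <= a ->
  exists fs : seq {ffun 'I_N -> V}, size fs = j /\
    #|[set u : {ffun 'I_s -> 'I_N} | injectiveb u &&
         all (fun f : {ffun 'I_N -> V} => [forall x, forall y, ~~ adj (f (u x)) (f (u y))]) fs]|
      * (#|V| ^ s) ^ j <= N ^ s * a ^ j.
Proof.
move=> V_gt0 le_a; elim: j => [|j [fs [sz_fs IH]]].
  exists [::]; split=> //; rewrite !expn0 !muln1.
  by apply: leq_trans (max_card _) _; rewrite card_ffun !card_ord.
set U := [set u | _] in IH.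
pose bad (u : {ffun 'I_s -> 'I_N}) (f : {ffun 'I_N -> V}) :=
  [forall x, forall y, ~~ adj (f (u x)) (f (u y))].
have [||f fP] := @exists_le_average _ _ U bad a (#|V| ^ s).
- by rewrite card_ffun expn_gt0 V_gt0.
- move=> u; rewrite inE => /andP[/injectiveP uinj _].
  have := @card_ffun_comp_inj _ _ V u
    (fun g : {ffun _} => [forall x, forall y, ~~ adj (g x) (g y)]) uinj.
  rewrite card_ffun card_ord => H.
  apply: leq_trans (leq_trans H (leq_mul (leqnn _) le_a)).
  rewrite leq_mul2r; apply/orP; right; apply/subset_leq_card/subsetP => f; rewrite !inE.
  move=> /forallP fP; apply/forallP => x; apply/forallP => y; rewrite !ffunE.
  by have /forallP := fP x.
exists (f :: fs); split; first by rewrite /= sz_fs.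
rewrite expnS [a ^ _.+1]expnS mulnA.
have -> : [set u : {ffun 'I_s -> 'I_N} | injectiveb u &&
         all (fun f : {ffun 'I_N -> V} => [forall x, forall y, ~~ adj (f (u x)) (f (u y))]) (f :: fs)]
    = [set u in U | bad u f].
  by apply/setP => u; rewrite !inE /= andbA andbAC.
apply: leq_trans (leq_mul fP (leqnn _)) _.
by rewrite mulnAC [leqRHS]mulnCA [leqRHS]mulnC leq_mul2r IH orbT.
Qed.

(** * Colourings without large monochromatic cliques *)

Lemma card_lt_pairs (s : nat) : #|{: {p : 'I_s * 'I_s | p.1 < p.2}}| = 'C(s, 2).
Proof.
rewrite card_sig -bin2_sum big_mkord -sum1_card.
rewrite (partition_big (fun p => p.2) xpredT) //=; apply: eq_bigr => y _.
rewrite sum1dep_card -[RHS]card_ord -cardsT.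
rewrite -(card_imset _ (_ : injective (fun x => (widen_ord (ltnW (ltn_ord y)) x, y)))).
  apply: eq_card => -[x z]; rewrite !inE /=; apply/andP/imsetP => [[xz /eqP zy]|[t _ [-> ->]]] //=.
  rewrite {}zy in xz *; exists (Ordinal xz) => //; congr pair; exact: val_inj.
by move=> x z [] /val_inj.
Qed.

(** A normal form for unordered pairs: any function on ordered pairs becomes symmetric when read
    through it. *)
Definition sort_pair N (x y : 'I_N) := if x < y then (x, y) else (y, x).

Lemma sort_pairC N (x y : 'I_N) : sort_pair x y = sort_pair y x.
Proof. by rewrite /sort_pair; case: ltngtP => // /val_inj ->. Qed.

(** Distinct edges of the clique on [u] read distinct coordinates of the random colouring, so their
    colours are independent. *)
Lemma sort_pair_inj N s (u : 'I_s -> 'I_N) : injective u ->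
  injective (fun p : {p : 'I_s * 'I_s | p.1 < p.2} => sort_pair (u (val p).1) (u (val p).2)).
Proof.
move=> uinj [[x y] /= xy] [[x' y'] /= xy'] E; apply: val_inj => /=.
have : (u x = u x' /\ u y = u y') \/ (u x = u y' /\ u y = u x').
  by move: E; rewrite /sort_pair; do 2 case: ifP => _; case=> -> ->; auto.
case=> -[/uinj ex /uinj ey]; first by rewrite ex ey.
by move: xy xy'; rewrite ex ey; lia.
Qed.

Lemma card_constant_ffun (E : finType) :
  #|[set g : {ffun E -> bool} | [exists b, forall p, g p == b]]| <= 2.
Proof.
rewrite -card_bool; apply: leq_trans (leq_imset_card (fun b => [ffun=> b] : {ffun E -> bool}) _).
apply/subset_leq_card/subsetP => g; rewrite inE => /existsP[b /forallP gb].
by apply/imsetP; exists b => //; apply/ffunP => p; rewrite ffunE; apply/eqP.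
Qed.

(* Colour [i < j] of a pair means that the pull-back along the [i]-th function is the first in
   which it is an edge; pairs that are an edge in no pull-back are coloured at random with the
   last two colours. *)
Lemma exists_coloring (V : finType) (adj : rel V) (s N j a : nat) :
    symmetric adj -> irreflexive adj ->
    (forall g : 'I_s -> V, ~ (forall x y, x != y -> adj (g x) (g y))) ->
    0 < #|V| ->
    #|[set g : {ffun 'I_s -> V} | [forall x, forall y, ~~ adj (g x) (g y)]]| <= a ->
    N ^ s * a ^ j * 2 < (#|V| ^ s) ^ j * 2 ^ 'C(s, 2) ->
  exists c : 'I_N -> 'I_N -> 'I_j.+2, (forall x y, c x y = c y x) /\
    forall (u : 'I_s -> 'I_N) i, injective u -> ~ (forall x y, x != y -> c (u x) (u y) = i).
Proof.
move=> adjC adjI noclique V_gt0 le_a lt_N.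
have [fs [sz_fs]] := exists_pullbacks N j V_gt0 le_a.
set U := [set u | _] => cardU.
pose E := {p : 'I_s * 'I_s | p.1 < p.2}.
pose pr (u : {ffun 'I_s -> 'I_N}) (p : E) := sort_pair (u (val p).1) (u (val p).2).
pose mono (u : {ffun 'I_s -> 'I_N}) (w : {ffun 'I_N * 'I_N -> bool}) :=
  [exists b, forall p : E, w (pr u p) == b].
have [||w wP] := @exists_le_average _ _ U mono 2 (2 ^ 'C(s, 2)).
- by rewrite card_ffun expn_gt0 card_bool.
- move=> u; rewrite inE => /andP[/injectiveP uinj _].
  have := card_ffun_comp_inj (fun g : {ffun E -> bool} => [exists b, forall p, g p == b])
    (sort_pair_inj uinj).
  rewrite card_ffun card_bool card_lt_pairs => H.
  apply: leq_trans (leq_trans H (leq_mul (leqnn _) (card_constant_ffun E))).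
  rewrite leq_mul2r; apply/orP; right; apply/subset_leq_card/subsetP => f; rewrite !inE.
  move=> /existsP[b /forallP fb]; apply/existsP; exists b; apply/forallP => p.
  by rewrite ffunE; apply: fb.
(* By [lt_N] the average number of surviving monochromatic tuples is below 1, hence 0 for this
   [w]. *)
have U0 : [set u in U | mono u w] = set0.
  apply/eqP; rewrite -cards_eq0 -leqn0 leqNgt; apply/negP => bad_gt0.
  have : 2 ^ 'C(s, 2) <= #|U| * 2 by apply: leq_trans wP; rewrite leq_pmull.
  move/(leq_mul (leqnn ((#|V| ^ s) ^ j))); rewrite leqNgt => /negP[].
  by apply: leq_trans lt_N; rewrite ltnS mulnA leq_mul2r [_ * #|U|]mulnC cardU orbT.
(* [find] returns the length [j] when no pull-back has the edge; [w] then selects colour [j] or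
   [j.+1]. *)
pose k x y := find (fun f : {ffun 'I_N -> V} => adj (f x) (f y)) fs.
pose col x y := if k x y < j then k x y else j + w (sort_pair x y).
have col_lt x y : col x y < j.+2.
  by rewrite /col; case: ifP => [|_]; [lia | case: (w _); lia].
exists (fun x y => inord (col x y)); split.
  move=> x y; rewrite /col sort_pairC; have -> // : k x y = k y x.
  by apply: eq_find => f; rewrite adjC.
move=> u i uinj ui.
have {}ui x y : x != y -> col (u x) (u y) = i.
  by move=> /ui <-; rewrite inordK.
have [i_lt_j|j_le_i] := ltnP i j.
  have [v _] := card_gt0P V_gt0.
  apply: (noclique (fun x => nth [ffun=> v] fs i (u x))) => x y xy.
  have := ui _ _ xy; rewrite /col; case: ifP => [k_lt <-|]; last by lia.
  by apply: (nth_find _ (a := fun f : {ffun 'I_N -> V} => adj (f (u x)) (f (u y)))); rewrite has_find sz_fs.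
have kP x y : x != y -> (j <= k (u x) (u y)) /\ w (sort_pair (u x) (u y)) = (j < i) :> bool.
  move=> xy; have := ui _ _ xy; rewrite /col; case: ltnP => [|_ <-]; first by lia.
  by split=> //; case: (w _); lia.
have : [ffun x => u x] \in [set u in U | mono u w].
  rewrite !inE; apply/andP; split; last first.
    apply/existsP; exists (j < i); apply/forallP => p; rewrite /pr !ffunE; apply/eqP.
    have xy : (val p).1 != (val p).2 by have := valP p; rewrite -val_eqE /=; lia.
    by case: (kP _ _ xy).
  apply/andP; split; first by apply/injectiveP => x y; rewrite !ffunE => /uinj.
  apply/allP => f fs_f; apply/forallP => x; apply/forallP => y; rewrite !ffunE.
  case: (eqVneq x y) => [->|xy]; first by rewrite adjI.
  have [+ _] := kP _ _ xy; rewrite -sz_fs leqNgt -has_find => /hasPn.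
  exact.
by rewrite U0 inE.
Qed.

(** Here [s = 2 m + 2] is even and exceeds [2 m], so [s]-cliques are excluded. The hypothesis times
    [m.+1], halved, is the comparison of exponents of 2 in [exists_coloring]; [0 < m] makes that
    comparison strict. *)
Lemma exists_symplectic_coloring (m j a : nat) :
    0 < m -> 4 * a + 4 * j <= 3 * m * j + 4 * m ->
  exists c : 'I_(2 ^ a) -> 'I_(2 ^ a) -> 'I_j.+2, (forall x y, c x y = c y x) /\
    forall (u : 'I_(m + m).+2 -> 'I_(2 ^ a)) i,
      injective u -> ~ (forall x y, x != y -> c (u x) (u y) = i).
Proof.
move=> m_gt0 le_a.
apply: (exists_coloring (adj := fun x y : 'rV['F_2]_(m + m) => ~~ perp x y)
  (a := 2 ^ ((m + m).+2 * m.+1 + 'C(m.+1, 2)))).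
- by move=> x y /=; rewrite perp_sym.
- by move=> x; rewrite perp_xx.
- move=> g gP; have := non_perp_family_size (g := g) _ gP.
  by rewrite /= addnn odd_double => /(_ isT); rewrite -ltnS ltnNge leqnSn.
- by rewrite card_mx card_Fp // expn_gt0.
- apply: leq_trans (card_perp_family m _); apply/subset_leq_card/subsetP => g.
  rewrite !inE => /forallP gP; apply/forallP => x; apply/forallP => y.
  by have /forallP/(_ y) := gP x; rewrite negbK.
rewrite card_mx card_Fp // mul1n -!expnM -!expnD -expnSr ltn_exp2l //.
have := mul_bin_diag (m + m).+2 1; have := mul_bin_diag m.+1 1; rewrite !bin1 /=.
set b := 'C(m.+1, 2); set d := 'C(_, 2) => Eb Ed.
have : m.+1 * m * j = 2 * b * j by rewrite Eb.
by have := leq_mul (leqnn m.+1) le_a; lia.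
Qed.

(** * The blow-up and the graph *)

(** As [v] is adjacent to everything, a copy in the last colour stays in one block, which is too
    small. In any other colour the clique [h] meets each block at most once and gives a clique
    excluded by [c]. *)
Lemma not_arrows_blowup (V : finType) (e : rel V) (v : V) (n M Q s : nat)
    (c : 'I_M -> 'I_M -> 'I_Q) (h : 'I_s -> V) :
    (forall x y, c x y = c y x) ->
    (forall (u : 'I_s -> 'I_M) i, injective u -> ~ (forall x y, x != y -> c (u x) (u y) = i)) ->
    n < #|V| -> (forall x, x != v -> e v x) ->
    (forall x y, x != y -> e (h x) (h y)) ->
  ~ arrows e Q.+1 (M * n).
Proof.
move=> csym cP ltnV ev eh arr.
have n_gt0 (x : 'I_(M * n)) : 0 < n by case: n x {ltnV arr} => [|//]; rewrite muln0 => -[].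
have part_lt (x : 'I_(M * n)) : x %/ n < M by rewrite ltn_divLR ?(n_gt0 x).
pose part x := Ordinal (part_lt x).
pose col x y := if part x == part y then ord_max else widen_ord (leqnSn Q) (c (part x) (part y)).
have [|f [finj [i fi]]] := arr col.
  by move=> x y; rewrite /col eq_sym csym.
have [iQ|iQ] := eqVneq i ord_max.
  have fpart x : part (f x) = part (f v).
    have [->//|xv] := eqVneq x v; have := fi _ _ (ev _ xv); rewrite iQ /col.
    case: eqP => [->//|_ /(congr1 val) /= E].
    by have := ltn_ord (c (part (f v)) (part (f x))); rewrite E ltnn.
  have mod_lt x : f x %% n < n by rewrite ltn_mod (n_gt0 (f v)).
  suff /leq_card : injective (fun x => Ordinal (mod_lt x)) by rewrite card_ord leqNgt ltnV.
  move=> x y [] E; apply/finj/val_inj; rewrite /= (divn_eq (f x) n) (divn_eq (f y) n) E.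
  by have /(congr1 val) /= -> := fpart x; have /(congr1 val) /= -> := fpart y.
have col_i x y : x != y -> part (f (h x)) != part (f (h y)) /\
    widen_ord (leqnSn Q) (c (part (f (h x))) (part (f (h y)))) = i.
  by move=> /eh /fi; rewrite /col; case: ifP => [_ E|]; [rewrite E eqxx in iQ | split].
have iQ' : i < Q.
  have := ltn_ord i; rewrite ltnS leq_eqVlt => /orP[/eqP E|//].
  by case/eqP: iQ; apply: val_inj.
apply: (cP (fun x => part (f (h x))) (Ordinal iQ')).
  move=> x y E; apply/eqP/contraT => /col_i[]; by rewrite E eqxx.
by move=> x y /col_i[_ /(congr1 val) E]; apply: val_inj.
Qed.

Lemma exists_graph (j n k m a : nat) (q := j.+3) :
    q ^ (q * k) <= n -> 0 < m -> (m + m).+2 <= k.+1 ->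
    4 * a + 4 * j <= 3 * m * j + 4 * m ->
  exists e : rel 'I_n.+1, simple_graph e /\ exists v : 'I_n.+1,
    ramsey_number (delete_vertex e v) q = n /\ 2 ^ a * n < ramsey_number e q.
Proof.
move=> le_n m_gt0 le_mk le_a.
have le_kn : k <= n.
  apply: leq_trans le_n; apply: leq_trans (ltnW (ltn_expl k (isT : 1 < q))) _.
  by rewrite leq_exp2l // leq_pmull.
(* The deleted vertex is [ord0]; the labels [0] to [k] form a clique, of which [1] to [k] remain in
   [H]. *)
pose e : rel 'I_n.+1 := fun x y =>
  (x != y) && [|| x == ord0, y == ord0 | (x <= k) && (y <= k)].
have eirr : irreflexive e by move=> x; rewrite /e eqxx.
exists e; split.
  split=> // x y; rewrite /e eq_sym; congr (_ && _).
  by rewrite orbCA [(x <= k) && _]andbC.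
have ramsey_e : exists N, arrows e q N.
  exists (n.+1 + q ^ (q * #|[set: 'I_n.+1]|)).
  apply: (@arrows_clique _ e q _ setT); rewrite ?card_ord ?leq_addr ?leq_addl //.
  by move=> x y _; rewrite !inE.
have card_del : #|{: {x : 'I_n.+1 | x != ord0}}| = n.
  rewrite card_sig -[RHS](succnK n) -[in RHS](card_ord n.+1) -(cardC1 ord0).
  by apply: eq_card => x; rewrite !inE.
exists ord0; split.
  have arr_n : arrows (delete_vertex e ord0) q n.
    pose A := [set x : {x : 'I_n.+1 | x != ord0} | (val x : 'I_n.+1) <= k].
    apply: (@arrows_clique _ _ _ _ A) => //.
    - by move=> x; rewrite /delete_vertex eirr.
    - move=> x y; rewrite /delete_vertex /e !inE => /andP[_].
      by have /negbTE -> := valP x; have /negbTE -> := valP y.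
    - by rewrite card_del.
    apply: leq_trans le_n; rewrite leq_exp2l // leq_mul2l; apply/orP; right.
    pose S := [set x : 'I_n.+1 | x <= k].
    have cardS : #|S| <= k.+1.
      rewrite -[leqRHS]card_ord; apply: leq_trans (leq_imset_card (fun i : 'I_k.+1 => inord i) _).
      apply/subset_leq_card/subsetP => x; rewrite inE -ltnS => xk.
      by apply/imsetP; exists (Ordinal xk) => //; apply: val_inj; rewrite /= inord_val.
    have S0 : ord0 \in S by rewrite inE.
    move: cardS; rewrite (cardsD1 ord0) S0 ltnS; apply: leq_trans.
    apply: (@card_le_in _ _ val); first by move=> x y _ _ /val_inj.
    by move=> x; rewrite !inE (valP x).
  have [arr_r r_min] := ramsey_numberP arr_n; apply/eqP; rewrite eqn_leq r_min //=.
  (* Any colouring yields an injection of the [n] vertices of [H], hence the lower bound [n]. *)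
  have [//|f [finj _]] := arr_r (fun _ _ => ord0).
  by have := leq_card f finj; rewrite card_ord card_del.
have [N /ramsey_numberP[arr_r _]] := ramsey_e.
rewrite ltnNge; apply/negP => /arrows_leq /(_ arr_r).
have [c [csym cP]] := exists_symplectic_coloring m_gt0 le_a.
apply: (not_arrows_blowup (v := ord0) (h := fun i : 'I_(m + m).+2 => inord i) csym cP).
- by rewrite card_ord.
- by move=> x x0; rewrite /e eq_sym x0 eqxx.
move=> x y xy; have xk (z : 'I_(m + m).+2) : z <= k by rewrite -ltnS (leq_trans (ltn_ord z)).
have xn (z : 'I_(m + m).+2) : z < n.+1 by rewrite ltnS (leq_trans (xk z)).
by rewrite /e -val_eqE /= !inordK // !xk !orbT andbT.
Qed.

(** * Choice of parameters and asymptotics *)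

Lemma ln_unbounded (x : R) : exists N : nat, forall n : nat, N <= n -> (x < ln (INR n))%R.
Proof.
have [N HN] := INR_unbounded (exp x).
exists N => n /leP/le_INR leNn; rewrite -[x]ln_exp; apply: ln_increasing; first exact: exp_pos.
by apply: Rlt_le_trans leNn.
Qed.

Lemma INR_expn (b k : nat) : INR (b ^ k) = (INR b ^ k)%R.
Proof. by elim: k => [|k IH] //; rewrite expnS -multE mult_INR IH. Qed.

Theorem theorem5p1 (q : nat) (hq : (3 <= q)%nat) :
  exists delta : nat -> R, Un_cv delta 0%R /\
  exists alpha : R, (0 < alpha)%R /\
  exists N0 : nat, forall n : nat, (N0 <= n)%nat ->
    exists e : rel 'I_n.+1, simple_graph e /\
    exists v : 'I_n.+1,
      (INR (ramsey_number e q) >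
         Rpower (INR n)
           (1 + (3 * INR q - 5) / (8 * INR q * log2 (INR q)) - delta n))%R /\
      ramsey_number (delete_vertex e v) q = n /\
      (INR (ramsey_number e q) >=
         Rpower (INR (ramsey_number (delete_vertex e v) q)) (1 + alpha))%R.
Proof.
have q3 : (3 <= INR q)%R by have := le_INR _ _ (leP hq); rewrite /=; lra.
have lnq : (0 < ln (INR q))%R by rewrite -ln_1; apply: ln_increasing; lra.
have ln2 := ln_lt_2; have {ln2}ln2 : (0 < ln 2)%R by lra.
pose gamma := ((3 * INR q - 5) / (8 * INR q * log2 (INR q)))%R.
have gammaE : (gamma * (8 * (INR q * ln (INR q))) = (3 * INR q - 5) * ln 2)%R.
  by rewrite /gamma /log2; field; split; lra.
have qlnq : (0 < INR q * ln (INR q))%R by apply: Rmult_lt_0_compat; lra.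
have gamma_gt0 : (0 < gamma)%R.
  apply: (Rmult_lt_reg_r (8 * (INR q * ln (INR q)))); first lra.
  by rewrite gammaE Rmult_0_l; apply: Rmult_lt_0_compat; lra.
(* The exponent [C / ln n] amounts to a constant factor [2 ^ (3 q)], which absorbs all rounding
   losses below. *)
pose C := (3 * INR q * ln 2)%R.
have C_gt0 : (0 < C)%R by apply: Rmult_lt_0_compat; lra.
exists (fun n => C / ln (INR n))%R; split.
  move=> eps eps_gt0; have [N HN] := ln_unbounded (C / eps)%R.
  exists N => n /leP /HN lnn; rewrite /Rdist Rminus_0_r.
  have lnn_gt0 : (0 < ln (INR n))%R.
    by apply: Rlt_trans lnn; apply: Rdiv_lt_0_compat.
  rewrite Rabs_pos_eq; last by apply/Rlt_le/Rdiv_lt_0_compat.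
  apply: (Rmult_lt_reg_r (ln (INR n))) => //.
  have -> : (C / ln (INR n) * ln (INR n) = C / eps * eps)%R by field; lra.
  by rewrite [(eps * _)%R]Rmult_comm; apply: Rmult_lt_compat_r.
exists (gamma / 2)%R; split; first lra.
(* Beyond [2 * C / gamma] the loss [C] is at most half of [gamma * ln n], which leaves
   [alpha = gamma / 2]. *)
have [N1 HN1] := ln_unbounded (Rmax 1 (2 * C / gamma)).
exists (maxn N1 ((q ^ q) ^ 5)) => n; rewrite geq_max => /andP[/HN1 lnn n_big].
have lnn_ge1 : (1 < ln (INR n))%R by apply: Rle_lt_trans lnn; apply: Rmax_l.
have n_gt0 : (0 < INR n)%R.
  by apply/lt_0_INR/ltP; apply: leq_trans n_big; rewrite !expn_gt0 (leq_trans _ hq).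
have b_gt1 : 1 < q ^ q by rewrite -(expn0 q) ltn_exp2l; lia.
(* [k] is the largest clique size with [q ^ (q * k) <= n], and [m] is the largest integer with
   [2 m + 2 <= k + 1]. The fifth power in the threshold gives [m >= 2], so that the subtraction of
   [4 * j] in [a] is not truncated. *)
pose k := trunc_log (q ^ q) n; pose m := k.-1./2.
have k_ge5 : 5 <= k by apply: trunc_log_max.
have m_gt1 : 1 < m by rewrite /m; lia.
pose j := q - 3; have qE : q = j.+3 by rewrite /j; lia.
pose a := (3 * m * j + 4 * m - 4 * j) %/ 4.
have [le_kn lt_nk] : (q ^ q) ^ k <= n /\ n < (q ^ q) ^ k.+1.
  apply/andP/trunc_log_bounds => //.
  by apply: leq_trans n_big; rewrite !expn_gt0; lia.
have a_le : 4 * a <= 3 * m * j + 4 * m - 4 * j by rewrite mulnC leq_divM.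
have a_ge : 3 * m * j + 4 * m - 4 * j < 4 * a.+1 by rewrite [ltnRHS]mulnC; apply: ltn_ceil.
(* Rounding in [m] costs [3 * (3 j + 4)], and the definition of [a] costs [8 j + 8]; the total
   [17 j + 20] is below [17 q]. *)
have le_ak : (3 * j + 4) * k.+1 <= 8 * a + 17 * q.
  have k_le : k.+1 <= 2 * m + 3 by rewrite /m; lia.
  by rewrite qE; have := leq_mul (leqnn (3 * j + 4)) k_le; clear -a_ge; lia.
have le_a : 4 * a + 4 * j <= 3 * m * j + 4 * m.
  by have := leq_mul m_gt1 (leqnn j); clear -a_le; lia.
have [||||e [e_simple [v [delE ramsey_gt]]]] := @exists_graph j n k m a.
- by rewrite -qE expnM.
- exact: ltnW.
- by rewrite /m; lia.
- by [].
rewrite -qE in delE ramsey_gt.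
(* Since [n < q ^ (q * k.+1)], the left side is below [(3 q - 5) * k.+1 * ln 2 / 8]; then [le_ak]
   applies, with [17 / 8 < 3]. *)
have gamma_ln : (gamma * ln (INR n) <= (INR a + 3 * INR q) * ln 2)%R.
  have lnn_lt : (ln (INR n) < INR k.+1 * (INR q * ln (INR q)))%R.
    have := ln_increasing _ _ n_gt0 (lt_INR _ _ (ltP lt_nk)).
    by rewrite !INR_expn !ln_pow; [|lra|apply: pow_lt; lra].
  have jE : (3 * INR q - 5 = INR (3 * j + 4))%R.
    by rewrite qE !S_INR plus_INR mult_INR /=; lra.
  have le_akR : ((3 * INR q - 5) * INR k.+1 <= 8 * INR a + 17 * INR q)%R.
    have <- : INR 8 = 8%R by rewrite /=; lra.
    have <- : INR 17 = 17%R by rewrite /=; lra.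
    by rewrite jE -!mult_INR -plus_INR; apply: le_INR (leP le_ak).
  have H1 := Rmult_lt_compat_l _ _ _ gamma_gt0 lnn_lt.
  have H2 := Rmult_le_compat_r _ _ _ (Rlt_le _ _ ln2) le_akR.
  have H3 : (gamma * (INR k.+1 * (INR q * ln (INR q))) =
      (3 * INR q - 5) * INR k.+1 * ln 2 / 8)%R.
    rewrite [((3 * INR q - 5) * INR k.+1)%R]Rmult_comm Rmult_assoc -gammaE.
    by field.
  have H4 : (0 < INR q * ln 2)%R by apply: Rmult_lt_0_compat; lra.
  by lra.
have lower (x : R) : (x * ln (INR n) <= ln (INR n) + INR a * ln 2)%R ->
    (INR (ramsey_number e q) > Rpower (INR n) x)%R.
  move=> le_x; apply: Rle_lt_trans (_ : (INR (2 ^ a * n) < _)%R); last exact/lt_INR/ltP.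
  rewrite -multE mult_INR INR_expn -[INR 2]/2%R -Rpower_pow; last lra.
  rewrite /Rpower -[X in (_ <= _ * X)%R](exp_ln _ n_gt0) -exp_plus.
  have {}le_x : (x * ln (INR n) <= INR a * ln 2 + ln (INR n))%R by lra.
  by case: (Rle_lt_or_eq_dec _ _ le_x) => [/exp_increasing/Rlt_le //|->]; lra.
exists e; split=> //; exists v; split; last split=> //.
- apply: lower; rewrite -/gamma.
  have -> : ((1 + gamma - C / ln (INR n)) * ln (INR n) = ln (INR n) + gamma * ln (INR n) - C)%R.
    by field; lra.
  by rewrite /C; lra.
rewrite delE; apply/Rgt_ge/lower.
have : (C <= gamma / 2 * ln (INR n))%R.
  have := Rmax_r 1 (2 * C / gamma); move=> H.
  have -> : (C = gamma / 2 * (2 * C / gamma))%R by field; lra.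
  by apply: Rmult_le_compat_l; lra.
by rewrite /C; lra.
Qed.
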